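(* Let $m\ge 2$, let $A\leqslant \mathcal{A}_m$ be a self-similar abelian group, let $\Delta=\langle x_1,\dots,x_s\rangle$ be the monoid of partial diagonal monomorphisms associated with the orbits of $A$ on the first level, and let $A^*=C_{\mathcal{A}_m}(\Delta(A))$ be the centralizer of $\Delta(A)$ in $\mathcal{A}_m$. Then there exists a finitely generated subgroup $H$ of $B(A)$ such that $A^*=\overline{\Delta(H)}$.
   Context: Tree automorphisms. $Y=\{1,\dots,m\}$, $\mathcal{T}_m$ is the rooted $m$-ary tree whose vertices are the finite words over $Y$ (root the empty word, edges $(u,uy)$ with $y\in Y$), and $\mathcal{A}_m$ is its automorphism group, acting on the right. Each $\alpha\in\mathcal{A}_m$ is written $\alpha=(\alpha_1,\dots,\alpha_m)\sigma(\alpha)$, where $\sigma(\alpha)\in Sym(Y)$ is the permutation induced on the first level (the activity of $\alpha$), $\alpha_y\in\mathcal{A}_m$, and $(y_1y_2\cdots y_n)^{\alpha}=(y_1)^{\sigma(\alpha)}(y_2\cdots y_n)^{\alpha_{y_1}}$. The set of states of $\alpha$ is defined recursively by $Q(\alpha)=\{\alpha\}\cup\bigcup_{i}Q(\alpha_i)$. A subgroup $G\leqslant\mathcal{A}_m$ is self-similar if $Q(\alpha)\subseteq G$ for all $\alpha\in G$. The identity is $e$. $\mathcal{A}_m$ is a topological group in which the pointwise stabilizers of the levels form a basis of neighbourhoods of $e$; a bar denotes topological closure. Orbits. For $G\leqslant\mathcal{A}_m$, $P(G)\leqslant Sym(m)$ is the group of activities of elements of $G$. Its orbits on $Y$ are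 $O_{(1)}=\{1,\dots,m_1\}$, $O_{(2)}=\{m_1+1,\dots,m_1+m_2\}$, $\dots$, $O_{(s)}=\{m_1+\dots+m_{s-1}+1,\dots,m\}$. $P_{(i)}$ is the transitive group induced by $P(G)$ on $O_{(i)}$ (viewed as fixing the other points of $Y$). Each $\sigma\in P(G)$ decomposes as $\sigma=\sigma_{(1)}\cdots\sigma_{(s)}$ with $\sigma_{(i)}\in P_{(i)}$. $B(G)$. For $\alpha=(\alpha_1,\dots,\alpha_m)\sigma\in G$, let $\alpha_{[i]}\in\mathcal{A}_m$ be the automorphism with activity $\sigma_{(i)}$, with first-level state $\alpha_y$ at each $y\in O_{(i)}$ and $e$ at each $y\notin O_{(i)}$. Put $G_{[i]}=\{\alpha_{[i]}\mid\alpha\in G\}$ and $B(G)=G_{[1]}\cdots G_{[s]}$ (a direct product). $\Delta$. For $1\le i\le s$, $x_i:\mathcal{A}_m\to\mathcal{A}_m$ sends $\alpha$ to the automorphism with trivial activity having $\alpha$ in every coordinate from $O_{(i)}$ and $e$ in all other coordinates; the orbits used are those of $A$. $\Delta=\langle x_1,\dots,x_s\rangle$ is the monoid generated under composition (maps written on the right as exponents), and for a subgroup $H$, $\Delta(H)=\langle H^{\omega}\mid\omega\in\Delta\rangle$.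
   Formalization: The group A is assumed non-trivial: for A = {e} the claim fails, since then A* is all of the automorphism group of the tree while B(A) = {e} forces the closure of Δ(H) to be {e}. *)

(* Defs.v *)
From HB Require Import structures.
From mathcomp Require Import all_boot all_order all_fingroup.
From mathcomp Require Import all_classical.
From mathcomp Require Import topology_structure.

Set Implicit Arguments.
Unset Strict Implicit.
Unset Printing Implicit Defensive.

Local Open Scope classical_set_scope.
Local Open Scope group_scope.

(** The rooted [m]-ary tree has vertices [seq 'I_m] and root [[::]]; its edges
    are directed away from the root. *)

Definition tree_edge (m : nat) (u v : seq 'I_m) : bool :=
  [exists y : 'I_m, v == rcons u y].

Record tree_aut (m : nat) := TreeAut {
  tree_fun :> seq 'I_m -> seq 'I_m;
  tree_bij : bijective tree_fun;
  tree_root : tree_fun [::] = [::];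
  tree_mono : {mono tree_fun : u v / tree_edge u v}
}.

HB.instance Definition _ (m : nat) := gen_eqMixin (tree_aut m).
HB.instance Definition _ (m : nat) := gen_choiceMixin (tree_aut m).

Section EdgeTheory.
Variable m : nat.
Implicit Types (u v : seq 'I_m) (y z : 'I_m).

Lemma tree_edgeP u v : reflect (exists y, v = rcons u y) (tree_edge u v).
Proof. by apply: (iffP existsP) => -[y]; [move/eqP | move=> ->]; exists y. Qed.

Lemma tree_edge_nilr u : tree_edge u [::] = false.
Proof. by apply/tree_edgeP => -[y]; case: u. Qed.

Lemma tree_edge_nill z v : tree_edge [::] (z :: v) = (v == [::]).
Proof.
apply/tree_edgeP/eqP => [[y [_ ->]] //|->].
by exists z.
Qed.

Lemma tree_edge_cons y z u v :
  tree_edge (y :: u) (z :: v) = (y == z) && tree_edge u v.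
Proof.
apply/tree_edgeP/andP => [[x [-> ->]]|[/eqP -> /tree_edgeP[x ->]]].
  by split; [exact: eqxx | apply/tree_edgeP; exists x].
by exists x.
Qed.

End EdgeTheory.

Section TreeAutTheory.
Variable m : nat.
Implicit Types (g h : tree_aut m) (u v w : seq 'I_m) (y : 'I_m).

Lemma tree_autP g h : g =1 h -> g = h.
Proof.
case: g h => [f fb fr fm] [f' fb' fr' fm'] /= /funext ff'.
by subst f'; congr TreeAut; exact: Prop_irrelevance.
Qed.

Lemma tree_fun_rcons g u y : exists z, g (rcons u y) = rcons (g u) z.
Proof. by apply/tree_edgeP; rewrite tree_mono; apply/tree_edgeP; exists y. Qed.

Lemma size_tree_fun g u : size (g u) = size u.
Proof.
elim/last_ind: u => [|u y IH]; first by rewrite tree_root.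
by have [z ->] := tree_fun_rcons g u y; rewrite !size_rcons IH.
Qed.

Lemma tree_fun_cat g u w : take (size u) (g (u ++ w)) = g u.
Proof.
elim/last_ind: w => [|w y IH].
  by rewrite cats0 take_oversize// size_tree_fun.
rewrite -rcons_cat; have [z ->] := tree_fun_rcons g (u ++ w) y.
by rewrite -cats1 takel_cat// size_tree_fun size_cat leq_addr.
Qed.

Fact tree_one_bij : bijective (@id (seq 'I_m)).
Proof. by exists id. Qed.

Definition tree_one : tree_aut m :=
  @TreeAut m id tree_one_bij erefl (fun _ _ => erefl).

Fact tree_mul_root g h : (h \o g) [::] = [::].
Proof. by rewrite /= !tree_root. Qed.

Fact tree_mul_mono g h : {mono h \o g : u v / tree_edge u v}.
Proof. by move=> u v /=; rewrite !tree_mono. Qed.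

(** Automorphisms act on the right: [g * h] applies [g] first. *)
Definition tree_mul g h : tree_aut m :=
  TreeAut (bij_comp (tree_bij h) (tree_bij g)) (tree_mul_root g h)
          (tree_mul_mono g h).

Definition tree_inv_fun g : seq 'I_m -> seq 'I_m :=
  sval (cid (let: Bijective f' c1 c2 := tree_bij g in
             ex_intro (fun f' => cancel g f' /\ cancel f' g) f' (conj c1 c2))).

Lemma tree_funK g : cancel g (tree_inv_fun g).
Proof. by rewrite /tree_inv_fun; case: cid => ? []. Qed.

Lemma tree_inv_funK g : cancel (tree_inv_fun g) g.
Proof. by rewrite /tree_inv_fun; case: cid => ? []. Qed.

Fact tree_inv_root g : tree_inv_fun g [::] = [::].
Proof. by rewrite -{1}(tree_root g) tree_funK. Qed.

Fact tree_inv_mono g : {mono tree_inv_fun g : u v / tree_edge u v}.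
Proof. by move=> u v; rewrite -(tree_mono g) !tree_inv_funK. Qed.

Definition tree_inv g : tree_aut m :=
  TreeAut (Bijective (tree_inv_funK g) (tree_funK g)) (tree_inv_root g)
          (tree_inv_mono g).

Fact tree_mulA : associative tree_mul.
Proof. by move=> a b c; exact: tree_autP. Qed.

Fact tree_mul1 : left_id tree_one tree_mul.
Proof. by move=> a; exact: tree_autP. Qed.

Fact tree_mulr1 : right_id tree_one tree_mul.
Proof. by move=> a; exact: tree_autP. Qed.

Fact tree_mulV : left_inverse tree_one tree_inv tree_mul.
Proof. by move=> a; apply: tree_autP => u; exact: tree_inv_funK. Qed.

Fact tree_mulrV : right_inverse tree_one tree_inv tree_mul.
Proof. by move=> a; apply: tree_autP => u; exact: tree_funK. Qed.

End TreeAutTheory.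

HB.instance Definition _ (m : nat) :=
  isGroup.Build (tree_aut m) (@tree_mulA m) (@tree_mul1 m) (@tree_mulr1 m)
    (@tree_mulV m) (@tree_mulrV m).

Section Topology.
Variable m : nat.
Implicit Types (g h : tree_aut m) (u : seq 'I_m).

Lemma tree_fun1 u : (1 : tree_aut m) u = u.
Proof. by []. Qed.

Lemma tree_funM g h u : (g * h) u = h (g u).
Proof. by []. Qed.

Definition level_stab (n : nat) : set (tree_aut m) :=
  [set g | forall u, size u = n -> g u = u].

Lemma level_stab_le n k : (k <= n)%N -> level_stab n `<=` level_stab k.
Proof.
move=> kn g gn [|y u] uk; first exact: tree_root.
rewrite -(tree_fun_cat g _ (nseq (n - k) y)) gn ?take_size_cat//.
by rewrite size_cat size_nseq uk subnKC.
Qed.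

Lemma level_stab1 n : level_stab n 1.
Proof. by []. Qed.

Lemma level_stabM n g h : level_stab n g -> level_stab n h -> level_stab n (g * h).
Proof. by move=> gn hn u un; rewrite tree_funM gn ?hn. Qed.

Definition tree_nbhs g : set_system (tree_aut m) :=
  filter_from [set: nat] (fun n => [set g * h | h in level_stab n]).

End Topology.

HB.instance Definition _ (m : nat) := hasNbhs.Build (tree_aut m) (@tree_nbhs m).

Section TopologyInstance.
Variable m : nat.

Fact tree_nbhs_filter (g : tree_aut m) : ProperFilter (nbhs g).
Proof.
apply: filter_from_proper; last first.
  by move=> n _; exists (g * 1); exists 1.
apply: filter_from_filter; first by exists 0%N.
move=> i j _ _; exists (maxn i j) => // _ [h hij <-].
by split; exists h => //; apply: level_stab_le hij; rewrite ?leq_maxl ?leq_maxr.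
Qed.

Fact tree_nbhs_singleton (g : tree_aut m) (A : set (tree_aut m)) :
  nbhs g A -> A g.
Proof. by move=> [n _]; apply; exists 1 => //; rewrite mulg1. Qed.

Fact tree_nbhs_nbhs (g : tree_aut m) (A : set (tree_aut m)) :
  nbhs g A -> nbhs g (nbhs^~ A).
Proof.
move=> [n _ nA]; exists n => // _ [h hn <-]; exists n => // _ [k kn <-].
by apply: nA; exists (h * k); [exact: level_stabM | rewrite mulgA].
Qed.

End TopologyInstance.

HB.instance Definition _ (m : nat) :=
  Nbhs_isNbhsTopological.Build (tree_aut m)
    (@tree_nbhs_filter m) (@tree_nbhs_singleton m) (@tree_nbhs_nbhs m).

Section Wreath.
Variable m : nat.
Implicit Types (g : tree_aut m) (u w : seq 'I_m) (y : 'I_m).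

Definition activity_fun g y : 'I_m := head y (g [:: y]).

Lemma tree_fun_letter g y : g [:: y] = [:: activity_fun g y].
Proof.
by rewrite /activity_fun; case: (g _) (size_tree_fun g [:: y]) => [|z []].
Qed.

Fact activity_fun_inj g : injective (activity_fun g).
Proof.
move=> y z eyz; have := bij_inj (tree_bij g).
by move=> /(_ [:: y] [:: z]); rewrite !tree_fun_letter eyz => /(_ erefl)[].
Qed.

Definition activity g : {perm 'I_m} := perm (@activity_fun_inj g).

Definition state_fun g y w : seq 'I_m := behead (g (y :: w)).

Lemma tree_fun_cons g y w : g (y :: w) = activity g y :: state_fun g y w.
Proof.
rewrite permE /state_fun; have := tree_fun_cat g [:: y] w.
rewrite tree_fun_letter cat1s; case: (g (y :: w)) => //= z t.
by rewrite take0 => /eqP; rewrite eqseq_cons andbT => /eqP ->.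
Qed.

Lemma tree_fun_activity g y : g [:: y] = [:: activity g y].
Proof. by rewrite tree_fun_letter permE. Qed.

Lemma activityV g y : activity g^-1 (activity g y) = y.
Proof.
have := tree_fun_activity g^-1 (activity g y).
by rewrite -(tree_fun_activity g y) -tree_funM mulgV => -[].
Qed.

Fact state_fun_bij g y : bijective (state_fun g y).
Proof.
exists (state_fun (g^-1) (activity g y)) => w.
- by rewrite {1}/state_fun -tree_fun_cons -tree_funM mulgV.
- have E : y :: state_fun g^-1 (activity g y) w = g^-1 (activity g y :: w).
    by rewrite tree_fun_cons activityV.
  by rewrite {1}/state_fun E -tree_funM mulVg.
Qed.

Fact state_fun_root g y : state_fun g y [::] = [::].
Proof. by rewrite /state_fun tree_fun_letter. Qed.

Fact state_fun_mono g y : {mono state_fun g y : u v / tree_edge u v}.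
Proof.
move=> u v; have := tree_mono g (y :: u) (y :: v).
by rewrite !tree_fun_cons !tree_edge_cons !eqxx.
Qed.

Definition state g y : tree_aut m :=
  TreeAut (state_fun_bij g y) (state_fun_root g y) (@state_fun_mono g y).

Implicit Types (a : 'I_m -> tree_aut m) (s : {perm 'I_m}).

Definition wreath_fun a s w : seq 'I_m :=
  if w is y :: w' then s y :: a y w' else [::].

Fact wreath_fun_bij a s : bijective (wreath_fun a s).
Proof.
exists (fun w => if w is z :: w'
                 then s^-1 z :: (a (s^-1 z))^-1 w' else [::]) => -[|y w] //=.
- by rewrite permK tree_funK.
- by rewrite permKV tree_inv_funK.
Qed.

Fact wreath_fun_mono a s : {mono wreath_fun a s : u v / tree_edge u v}.
Proof.
move=> [|y u] [|z v] //=; rewrite ?tree_edge_nilr//.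
  by rewrite !tree_edge_nill -!size_eq0 size_tree_fun.
rewrite !tree_edge_cons (inj_eq perm_inj).
by have [->|//] := eqVneq y z; rewrite tree_mono.
Qed.

(** [(a_1, ..., a_m) s], the inverse of [g |-> (state g, activity g)]. *)
Definition wreath a s : tree_aut m :=
  TreeAut (wreath_fun_bij a s) erefl (@wreath_fun_mono a s).

Lemma wreath_eta g : g = wreath (state g) (activity g).
Proof. by apply: tree_autP => -[|y w]; rewrite /= ?tree_root ?tree_fun_cons. Qed.

Lemma activity_wreath a s : activity (wreath a s) = s.
Proof. by apply/permP => y; rewrite permE. Qed.

Lemma state_wreath a s y : state (wreath a s) y = a y.
Proof. exact: tree_autP. Qed.

End Wreath.

Inductive states (m : nat) (g : tree_aut m) : set (tree_aut m) :=
| states_refl : states g g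
| states_step (y : 'I_m) (h : tree_aut m) : states (state g y) h -> states g h.

Section Groups.
Variable m : nat.
Notation T := (tree_aut m).
Implicit Types (A G H S : set T) (O : {set 'I_m}).

Definition subgroup G : Prop := group_closed [in G].

Definition generated S : set T := smallest [set G | subgroup G] S.

Definition finitely_generated G : Prop :=
  exists2 S : set T, finite_set S & G = generated S.

Definition abelian_set G : Prop := forall a b, G a -> G b -> commute a b.

Definition centralizer_set S : set T := [set g | forall s, S s -> commute g s].

Definition self_similar G : Prop := forall a, G a -> states a `<=` G.

Definition activities G : {set {perm 'I_m}} :=
  finset.finset (fun s => `[< (@activity m @` G) s >]).

Definition level1_orbits G : {set {set 'I_m}} :=
  [set orbit 'P (activities G) y | y : 'I_m]%SET.

(** [restr_perm O s] acts as [s] on [O] and fixes the other points, provided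
    that [O] is [s]-invariant, as the orbits of [activities G] are. *)
Definition orbit_part O (a : T) : T :=
  wreath (fun y => if y \in O then state a y else 1)
         (restr_perm O (activity a)).

(** The factors commute, so the order in which [enum] lists the orbits does not
    matter. *)
Definition orbit_product G : set T :=
  [set \prod_(O <- enum (level1_orbits G)) b O | b in
    [set b : {set 'I_m} -> T |
      forall O, O \in level1_orbits G -> (orbit_part O @` G) (b O)]].

Definition partial_diag O (a : T) : T :=
  wreath (fun y => if y \in O then a else 1) 1.

Definition diag_monoid A : set (T -> T) :=
  smallest [set M | M id /\ forall f g, M f -> M g -> M (f \o g)]
           [set partial_diag O | O in [set` level1_orbits A]].

Definition diag_span A H : set T :=
  generated (\bigcup_(w in diag_monoid A) (w @` H)).

End Groups.

(* Main.v *)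
(** An element [g] of the centralizer preserves each orbit of [A] on the first
    level (as [A] is nontrivial, [partial_diag O a] detects [O]), and its states
    centralize [Delta(A)] again. On each orbit the activity of [g] agrees with
    that of an element of [A], so [g = k h] with [h] in [B(A)] and [k] of trivial
    activity; commuting with [A] forces the states of [k] to be constant on
    orbits, i.e. [k] is a product of [partial_diag O (k O)] with [k O] in the
    centralizer. Iterating on the [k O] approximates [g] on every level by
    elements of [Delta(H)], as soon as [H <= B(A)] realizes the finitely many
    activities of [B(A)]. *)

Require Import Defs.
From HB Require Import structures.
From mathcomp Require Import all_boot all_order all_fingroup.
From mathcomp Require Import all_classical.
From mathcomp Require Import topology_structure.

Local Open Scope classical_set_scope.
Local Open Scope group_scope.

(** * Subgroups, centralizers and closures of sets of tree automorphisms *)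

Section TreeGroups.

Set Implicit Arguments.
Unset Strict Implicit.
Variable m : nat.
Local Notation T := (tree_aut m).
(* [generated] alone denotes the operation on finite groups. *)
Local Notation generated := Defs.generated.
Implicit Types (g h : T) (G S : set T) (y : 'I_m) (w : seq 'I_m).

Lemma tree_aut_eq_cons g h : (forall y w, g (y :: w) = h (y :: w)) -> g = h.
Proof. by move=> gh; apply: tree_autP => -[|y w] //; rewrite !tree_root. Qed.

Lemma tree_fun_inj g : injective g.
Proof. exact: bij_inj (tree_bij g). Qed.

Lemma tree_funVK g w : g (g^-1 w) = w.
Proof. exact: tree_inv_funK. Qed.

Lemma tree_funV g h w : (h^-1 * g) (h w) = g w.
Proof. by rewrite -tree_funM mulgA mulgV mul1g. Qed.

Lemma state_funE g y w : g (y :: w) = activity g y :: state g y w.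
Proof. exact: tree_fun_cons. Qed.

Lemma commute_fun g h w : commute g h -> h (g w) = g (h w).
Proof. by move=> gh; rewrite -!tree_funM gh. Qed.

Lemma commute_tree g h : (forall w, h (g w) = g (h w)) -> commute g h.
Proof. by move=> gh; exact: tree_autP. Qed.

Lemma subgroupP G :
  subgroup G <-> G 1 /\ forall g h, G g -> G h -> G (g * h^-1).
Proof.
split=> -[G1 GM]; split.
- by move/set_mem: G1.
- by move=> g h Gg Gh; apply/set_mem/GM; exact: mem_set.
- exact: mem_set.
- by move=> g h /set_mem Gg /set_mem Gh; apply/mem_set/GM.
Qed.

Lemma subgroup1 G : subgroup G -> G 1.
Proof. by case/subgroupP. Qed.

Lemma subgroupMV G g h : subgroup G -> G g -> G h -> G (g * h^-1).
Proof. by case/subgroupP=> _; apply. Qed.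

Lemma subgroupV G g : subgroup G -> G g -> G g^-1.
Proof.
by move=> gG Gg; rewrite -[g^-1]mul1g; apply: subgroupMV => //; exact: subgroup1.
Qed.

Lemma subgroupM G g h : subgroup G -> G g -> G h -> G (g * h).
Proof.
by move=> gG Gg Gh; rewrite -[h]invgK; apply: subgroupMV => //; exact: subgroupV.
Qed.

Lemma subgroup_generated S : subgroup (generated S).
Proof.
apply/subgroupP; split=> [G [gG _]|g h Sg Sh G SG]; first exact: subgroup1.
by apply: subgroupMV; [case: SG | exact: Sg | exact: Sh].
Qed.

Lemma generated_sub S G : subgroup G -> S `<=` G -> generated S `<=` G.
Proof. exact: smallest_sub. Qed.

Lemma sub_generated S : S `<=` generated S.
Proof. exact: sub_gen_smallest. Qed.

Lemma subgroup_centralizer S : subgroup (centralizer_set S).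
Proof.
apply/subgroupP; split=> [s _|g h Cg Ch s Ss]; first exact: commute_sym (commute1 s).
apply: commute_sym; apply: commuteM; first exact/commute_sym/Cg.
by apply: commuteV; apply/commute_sym/Ch.
Qed.

Lemma centralizer_generated S :
  centralizer_set (generated S) = centralizer_set S.
Proof.
apply/seteqP; split=> g Cg s Ss; first by apply: Cg; apply: sub_generated.
have gC : subgroup [set s : T | commute g s].
  apply/subgroupP; split=> [|a b]; first exact: commute1.
  by move=> ga gb; apply: commuteM => //; exact: commuteV.
exact: (generated_sub gC Cg Ss).
Qed.

(** The cosets of [g] by the level stabilizers form a basis at [g], and [g] permutes each level. *)
Lemma closure_level G g :
  closure G g <->
  forall n, exists2 h, G h & forall w, size w = n -> h w = g w.
Proof.
split=> [cg n | Gg B [n _ nB]].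
  have [|x [Gx [h hn hx]]] := cg [set g * h | h in @level_stab m n].
    by exists n.
  exists x => // w wn; rewrite -hx tree_funM hn //.
  by rewrite size_tree_fun.
have [h Gh hg] := Gg n; exists h; split=> //; apply: nB.
exists (g^-1 * h); last by rewrite mulgA mulgV mul1g.
move=> w wn; have -> : w = g (g^-1 w) by rewrite tree_funVK.
by rewrite tree_funV hg // size_tree_fun.
Qed.

(** Commutation at [w] involves [g] only on the level of [w], where [g] agrees with some element of
    [G]. *)
Lemma closed_centralizer S G :
  G `<=` centralizer_set S -> closure G `<=` centralizer_set S.
Proof.
move=> GC g /closure_level Gg s Ss; apply: tree_autP => w.
have [h Gh hg] := Gg (size w); rewrite !tree_funM -!hg ?size_tree_fun //.
by rewrite -!tree_funM GC.
Qed.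

End TreeGroups.

Section AbelianSelfSimilar.
Set Implicit Arguments.
Unset Strict Implicit.
Variables (m : nat) (A : set (tree_aut m)).
Hypotheses (A_group : subgroup A) (A_abelian : abelian_set A).
Hypotheses (A_self_similar : self_similar A) (A_nontrivial : A <> [set 1]).
Local Notation T := (tree_aut m).
Local Notation generated := Defs.generated.
Local Notation orb := (orbit 'P (activities A)).
Local Notation centr := (centralizer_set (diag_span A A)).
Implicit Types (a b c d g h : T) (O : {set 'I_m}) (y z : 'I_m) (w : seq 'I_m).

(** * Orbits of [A] on the first level *)

Lemma activityM g h y : activity (g * h) y = activity h (activity g y).
Proof.
by have := tree_fun_activity (g * h) y; rewrite tree_funM !tree_fun_activity => -[].
Qed.

Lemma activity1 y : activity (1 : T) y = y.
Proof. by have := tree_fun_activity (1 : T) y; rewrite tree_fun1 => -[]. Qed.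

Lemma mem_orb y z : z \in orb y <-> exists2 a, A a & activity a y = z.
Proof.
split=> [/orbitP[s]|[a Aa <-]].
  by rewrite inE => /asboolP[a Aa <-] <-; exists a.
by apply/orbitP; exists (activity a) => //; rewrite inE; apply/asboolP; exists a.
Qed.

Lemma orb_refl y : y \in orb y.
Proof. by apply/mem_orb; exists 1; [exact: subgroup1 | exact: activity1]. Qed.

Lemma orb_eq y z : z \in orb y -> orb z = orb y.
Proof.
case/mem_orb=> a Aa <-; apply/setP => x; apply/idP/idP => /mem_orb[b Ab <-].
  by apply/mem_orb; exists (a * b); rewrite ?activityM //; exact: subgroupM.
apply/mem_orb; exists (a^-1 * b); last by rewrite activityM activityV.
by apply: subgroupM => //; exact: subgroupV.
Qed.

Lemma orb_eqE y z : (z \in orb y) = (orb z == orb y).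
Proof.
by apply/idP/eqP => [|<-]; [exact: orb_eq | exact: orb_refl].
Qed.

Lemma orb_act a y : A a -> orb (activity a y) = orb y.
Proof. by move=> Aa; apply: orb_eq; apply/mem_orb; exists a. Qed.

Lemma mem_level1_orbits O :
  O \in level1_orbits A <-> exists y, O = orb y.
Proof.
split=> [/imsetP[y _ ->]|[y ->]]; first by exists y.
exact: imset_f.
Qed.

Lemma orb_level1 y : orb y \in level1_orbits A.
Proof. by apply/mem_level1_orbits; exists y. Qed.

Lemma mem_orb_level1 O y : O \in level1_orbits A -> (y \in O) = (orb y == O).
Proof. by move/mem_level1_orbits=> [z ->]; exact: orb_eqE. Qed.

(** * Partial diagonals, orbit parts and [B(A)] in coordinates *)

Lemma partial_diag_cons O c y w :
  partial_diag O c (y :: w) = y :: (if y \in O then c w else w).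
Proof. by rewrite /= perm1; case: ifP. Qed.

Lemma orbit_part_cons O a y w : A a -> O \in level1_orbits A ->
  orbit_part O a (y :: w) = if y \in O then a (y :: w) else y :: w.
Proof.
move=> Aa LO; rewrite /orbit_part /=; case: ifP => yO; last first.
  by rewrite (out_perm (restr_perm_on _ _)) ?yO.
rewrite restr_permE //; first by rewrite -tree_fun_cons.
by apply/astabsP => x; rewrite /= apermE !mem_orb_level1 // orb_act.
Qed.

(** Each factor moves only words that start in its own orbit. The condition on the activity keeps
    the image of [y] in [orb y], so the factors that follow fix the result. *)
Lemma prod_orbits (f : {set 'I_m} -> T) y w :
  (forall O x v, O \in level1_orbits A -> x \notin O -> f O (x :: v) = x :: v) ->
  (activity (f (orb y)) y \in orb y) ->
  (\prod_(O <- enum (level1_orbits A)) f O) (y :: w) = f (orb y) (y :: w).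
Proof.
move=> f_out f_in.
have : {subset enum (level1_orbits A) <= level1_orbits A}.
  by move=> O; rewrite mem_enum.
have : orb y \in enum (level1_orbits A).
  by rewrite mem_enum orb_level1.
have : forall s, {subset s <= level1_orbits A} -> orb y \notin s ->
    forall x v, x \in orb y -> (\prod_(O <- s) f O) (x :: v) = x :: v.
  elim=> [|O s IH] sL ys x v xy; first by rewrite big_nil tree_fun1.
  move: ys; rewrite inE negb_or => /andP[yO ys].
  rewrite big_cons tree_funM f_out ?IH //.
  - by move=> P sP; rewrite sL // inE sP orbT.
  - by rewrite sL // mem_head.
  - by rewrite mem_orb_level1 ?sL ?mem_head // (orb_eq xy).
move=> out; elim: (enum _) (enum_uniq (mem (level1_orbits A))) => // O s IH.
rewrite cons_uniq => /andP[Os us] + sL.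
have sL' : {subset s <= level1_orbits A}.
  by move=> P sP; rewrite sL // inE sP orbT.
rewrite inE big_cons tree_funM; have [yO _|yO] := eqVneq (orb y) O.
  by rewrite -yO state_funE out // yO.
move=> /= ys; rewrite f_out ?IH //; first by rewrite sL // mem_head.
by rewrite mem_orb_level1 ?sL ?mem_head.
Qed.

Lemma prod_orbit_part (a : {set 'I_m} -> T) y w :
  (forall O, O \in level1_orbits A -> A (a O)) ->
  (\prod_(O <- enum (level1_orbits A)) orbit_part O (a O)) (y :: w)
    = a (orb y) (y :: w).
Proof.
move=> Aa; have Ay := Aa _ (orb_level1 y).
have yE v : orbit_part (orb y) (a (orb y)) (y :: v) = a (orb y) (y :: v).
  by rewrite orbit_part_cons ?orb_refl ?orb_level1.
rewrite prod_orbits ?yE // => [O x v LO xO|].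
  by rewrite orbit_part_cons ?(negPf xO) //; exact: Aa.
suff -> : activity (orbit_part (orb y) (a (orb y))) y = activity (a (orb y)) y.
  by rewrite orb_eqE orb_act.
by have := yE [::]; rewrite !tree_fun_activity => -[].
Qed.

(** Allows word-by-word computation in [B(A)] without expanding the product. *)
Lemma orbit_productP g :
  orbit_product A g <->
  exists2 a : {set 'I_m} -> T, forall O, O \in level1_orbits A -> A (a O)
    & forall y w, g (y :: w) = a (orb y) (y :: w).
Proof.
split=> [[b bA <-]|[a Aa ga]].
  have /choice[a aE] O : exists a, O \in level1_orbits A -> A a /\ b O = orbit_part O a.
    have [LO|nLO] := boolP (O \in level1_orbits A); last by exists 1.
    by have [a Aa aE] := bA O LO; exists a.
  have Aa O (LO : O \in level1_orbits A) : A (a O) by case: (aE O LO).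
  exists a => // y w; rewrite -prod_orbit_part //; congr (tree_fun _ _).
  by apply: eq_big_seq => O; rewrite mem_enum => LO; case: (aE O LO).
exists (fun O => orbit_part O (a O)).
  by move=> O LO; exists (a O) => //; exact: Aa.
by apply: tree_aut_eq_cons => y w; rewrite prod_orbit_part // ga.
Qed.

Lemma subgroup_orbit_product : subgroup (orbit_product A).
Proof.
apply/subgroupP; split=> [|g h].
  by apply/orbit_productP; exists (fun=> 1) => // O _; exact: subgroup1.
move=> /orbit_productP[a Aa ga] /orbit_productP[b Ab hb].
apply/orbit_productP; exists (fun O => a O * (b O)^-1) => [O LO|y w].
  by apply: subgroupMV => //; [exact: Aa | exact: Ab].
rewrite !tree_funM ga state_funE; set z := activity _ _; set v := state _ _ _.
(* Elements of [A] preserve orbits, so [h] is described by the same [b (orb y)] at [y] and at [z];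
   applying [h] to both sides removes the inverse. *)
have zy : orb z = orb y by rewrite orb_act //; exact/Aa/orb_level1.
have Abi : A (b (orb y))^-1 by apply: subgroupV => //; exact/Ab/orb_level1.
apply: (@tree_fun_inj _ h); rewrite tree_funVK.
by rewrite (state_funE _ z v) hb orb_act // zy -(state_funE _ z v) tree_funVK.
Qed.

(** * The monoid of partial diagonal maps *)

Lemma diag_monoid_id : diag_monoid A id.
Proof. by move=> M [[]]. Qed.

Lemma diag_monoid_comp f1 f2 :
  diag_monoid A f1 -> diag_monoid A f2 -> diag_monoid A (f1 \o f2).
Proof.
by move=> M1 M2 M MP; have [[_ MM] _] := MP; apply: MM; [exact: M1 | exact: M2].
Qed.

Lemma diag_monoid_partial O :
  O \in level1_orbits A -> diag_monoid A (partial_diag O).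
Proof. by move=> LO M [_]; apply; exists O. Qed.

(** The maps whose composition on the left preserves [P] form a submonoid that contains the
    generators; evaluating at [id] recovers [P]. *)
Lemma diag_monoid_ind (P : (T -> T) -> Prop) : P id ->
  (forall O f, O \in level1_orbits A -> diag_monoid A f -> P f ->
    P (partial_diag O \o f)) ->
  forall f, diag_monoid A f -> P f.
Proof.
move=> P1 PM f Mf.
suff: diag_monoid A f /\ forall f', diag_monoid A f' -> P f' -> P (f \o f').
  by case=> _ /(_ id diag_monoid_id P1).
apply: (Mf [set f0 | diag_monoid A f0 /\
  forall f', diag_monoid A f' -> P f' -> P (f0 \o f')]).
split; [split|].
- by split=> //; exact: diag_monoid_id.
- move=> f1 f2 [M1 P1'] [M2 P2']; split; first exact: diag_monoid_comp.
  by move=> f' Mf' Pf'; apply: P1'; [exact: diag_monoid_comp | exact: P2'].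
- by move=> _ [O LO <-]; split; [exact: diag_monoid_partial | move=> f'; exact: PM].
Qed.

(** * The centralizer of [Delta(A)]: activities and states *)

Lemma centrP g :
  centr g <-> forall f a, diag_monoid A f -> A a -> commute g (f a).
Proof.
rewrite /diag_span centralizer_generated; split=> [Cg f a Mf Aa|Cg s].
  by apply: Cg; exists f => //; exists a.
by case=> f Mf [a Aa <-]; exact: Cg.
Qed.

Lemma centr_commute g a : centr g -> A a -> commute g a.
Proof. by move=> /centrP Cg Aa; exact: Cg diag_monoid_id Aa. Qed.

Lemma A_state a y : A a -> A (state a y).
Proof.
by move=> Aa; apply: (A_self_similar Aa); apply: (@states_step _ _ y); exact: states_refl.
Qed.

(** As [g] preserves orbits, a letter and its image are both in [O] or both outside, so only the
    states over [O] have to be compared with [c]. *)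
Lemma commute_partial_diag O g c :
  O \in level1_orbits A -> (forall y, activity g y \in orb y) ->
  (forall y, y \in O -> commute (state g y) c) -> commute g (partial_diag O c).
Proof.
move=> LO gO gc; apply/commute_tree => -[|y w]; first by rewrite !tree_root.
rewrite partial_diag_cons (state_funE g) (state_funE g) partial_diag_cons.
rewrite !mem_orb_level1 // (orb_eq (gO y)).
case: eqP => // yO; congr (_ :: _).
by apply/commute_fun/gc; rewrite mem_orb_level1 // yO.
Qed.

Lemma A_activity a y : A a -> activity a y \in orb y.
Proof. by move=> Aa; rewrite orb_eqE orb_act. Qed.

Lemma A_commute_diag f a b : diag_monoid A f -> A a -> A b -> commute a (f b).
Proof.
move=> Mf Aa Ab; move: f Mf a Aa.
apply: diag_monoid_ind => [a Aa|O f LO Mf IH a Aa] /=; first exact: A_abelian.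
apply: commute_partial_diag => // y; first exact: A_activity.
by move=> _; apply: IH; exact: A_state.
Qed.

(** Elements of [A] have states in [A], which commute with [c]. Against another partial diagonal
    both activities are trivial, and each coordinate compares [c] with [f a] or with the
    identity. *)
Lemma centr_partial_diag O c :
  O \in level1_orbits A -> centr c -> centr (partial_diag O c).
Proof.
move=> LO Cc; apply/centrP => f a + Aa; move: f; apply: diag_monoid_ind => /=.
  apply/commute_sym/commute_partial_diag => // y; first exact: A_activity.
  by move=> _; apply/commute_sym/centr_commute => //; exact: A_state.
move=> O' f LO' Mf _; apply/commute_tree => -[|y w]; first by rewrite !tree_root.
rewrite !partial_diag_cons; congr (_ :: _).
case: ifP => //; case: ifP => // _ _; apply/commute_fun.
by move/centrP: Cc; apply.
Qed.

(** Over one orbit [g] acts as an element of [A], which commutes with all images of [A] under the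
    monoid; these images preserve the orbit. *)
Lemma centr_orbit_product g : orbit_product A g -> centr g.
Proof.
move=> /orbit_productP[a Aa ga].
have {}Aa y : A (a (orb y)) by exact/Aa/orb_level1.
apply/centrP => f b + Ab; move: f; apply: diag_monoid_ind => /=.
  apply/commute_tree => -[|y w]; first by rewrite !tree_root.
  rewrite ga (state_funE b) ga orb_act // -state_funE; apply/commute_fun.
  exact: A_abelian.
move=> O f LO Mf _; apply/commute_tree => -[|y w]; first by rewrite !tree_root.
have : commute (a (orb y)) (partial_diag O (f b)).
  by apply: A_commute_diag (diag_monoid_comp (diag_monoid_partial LO) Mf) _ _.
by move/commute_fun => /(_ (y :: w)); rewrite partial_diag_cons !ga.
Qed.

(** If [g] sent [y] out of its orbit, commutation with [partial_diag (orb y) a] would force [a = 1]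
    for every [a] in [A]. Nontriviality enters here: for trivial [A] the centralizer is the whole
    group. *)
Lemma centr_activity g y : centr g -> activity g y \in orb y.
Proof.
move=> Cg; apply: contra_notT A_nontrivial => gy; apply/seteqP; split=> a /=.
  move=> Aa; apply: tree_autP => w.
  have LO := orb_level1 y.
  move/centrP: Cg => /(_ _ a (diag_monoid_partial LO) Aa).
  move/commute_fun => /(_ (y :: w)); rewrite (state_funE g y w).
  rewrite (partial_diag_cons _ _ (activity g y)) (negPf gy) -state_funE => /tree_fun_inj.
  by rewrite partial_diag_cons orb_refl => -[].
by move=> ->; exact: subgroup1.
Qed.

(** Commutation of [g] with [partial_diag (orb y) (f a)], read on words from [y], is commutation of
    [state g y] with [f a]. *)
Lemma centr_state g y : centr g -> centr (state g y).
Proof.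
move=> Cg; apply/centrP => f a Mf Aa; apply/commute_tree => w.
have LO := orb_level1 y.
have : commute g (partial_diag (orb y) (f a)).
  move/centrP: Cg => /(_ (partial_diag (orb y) \o f) a); apply=> //.
  exact: diag_monoid_comp (diag_monoid_partial LO) Mf.
move/commute_fun => /(_ (y :: w)); rewrite (state_funE g y w).
rewrite (partial_diag_cons _ _ (activity g y)) centr_activity //.
by rewrite partial_diag_cons orb_refl (state_funE g) => -[].
Qed.

(* Two maps commuting with the transitive action of [A] on an orbit agree on it
   as soon as they agree at one point. *)
Lemma centr_activity_product g :
  centr g -> exists2 h, orbit_product A h & activity h = activity g.
Proof.
move=> Cg.
have /choice[a aE] O : exists a, O \in level1_orbits A ->
    A a /\ forall y, y \in O -> activity a y = activity g y.
  have [/mem_level1_orbits[y ->]|nLO] := boolP (O \in level1_orbits A); last by exists 1.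
  have /mem_orb[a Aa ag] := centr_activity y Cg; exists a => _; split=> // z.
  case/mem_orb=> b Ab <-; rewrite -activityM (A_abelian Ab Aa) activityM ag.
  by rewrite -!activityM (centr_commute Cg Ab).
have Aa O (LO : O \in level1_orbits A) : A (a O) by case: (aE O LO).
exists (\prod_(O <- enum (level1_orbits A)) orbit_part O (a O)).
  by exists (fun O => orbit_part O (a O)) => // O LO; exists (a O) => //; exact: Aa.
apply/permP => y; have [_ /(_ y (orb_refl y)) <-] := aE _ (orb_level1 y).
by have := prod_orbit_part y [::] Aa; rewrite !tree_fun_activity => -[].
Qed.

(** If [b] in [A] sends [y] to [z], commutation with [b] makes [state g z] the conjugate of
    [state g y] by [state b y]. The latter lies in [A], hence commutes with [state g y], and the
    conjugation is trivial. *)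
Lemma centr_state_const g y z :
  centr g -> activity g = 1 -> z \in orb y -> state g z = state g y.
Proof.
move=> Cg g1 /mem_orb[b Ab <-]; apply: tree_autP => w.
have [v <-] : exists v, state b y v = w by exists ((state b y)^-1 w); exact: tree_funVK.
have := commute_fun (y :: v) (centr_commute Cg Ab).
rewrite (state_funE g) g1 perm1 !(state_funE b) (state_funE g) => -[_ E].
rewrite -[LHS]E.
apply: (@commute_fun _ (state g y) (state b y)); apply: centr_commute.
  exact: centr_state.
exact: A_state.
Qed.

(** * Density of [Delta(H)] in the centralizer *)

Section DiagSpan.
Variable H : set T.
Hypothesis H_orbit_product : H `<=` orbit_product A.
Hypothesis H_activity :
  forall h, orbit_product A h -> exists2 h', H h' & activity h' = activity h.

Lemma diag_span_id h : H h -> diag_span A H h.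
Proof.
by move=> Hh; apply: sub_generated; exists id; [exact: diag_monoid_id | exists h].
Qed.

Lemma diag_span_centr : diag_span A H `<=` centr.
Proof.
apply: generated_sub; first exact: subgroup_centralizer.
move=> _ [f Mf [h Hh <-]]; move: f Mf; apply: diag_monoid_ind.
  exact/centr_orbit_product/H_orbit_product.
by move=> O f LO _; exact: centr_partial_diag.
Qed.

Lemma partial_diagMV O c d :
  partial_diag O (c * d^-1) = partial_diag O c * (partial_diag O d)^-1.
Proof.
apply: tree_aut_eq_cons => y w; apply: (@tree_fun_inj _ (partial_diag O d)).
rewrite tree_funM tree_funVK !partial_diag_cons; congr (_ :: _).
by case: (y \in O) => //; exact: tree_funVK.
Qed.

(** The preimage of [Delta(H)] under the homomorphism [partial_diag O] is a subgroup, and it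
    contains the generators. *)
Lemma diag_span_partial_diag O d : O \in level1_orbits A ->
  diag_span A H d -> diag_span A H (partial_diag O d).
Proof.
move=> LO; have gS := @subgroup_generated m (\bigcup_(w in diag_monoid A) (w @` H)).
apply: (@generated_sub _ _ [set d | diag_span A H (partial_diag O d)]).
  apply/subgroupP; split=> [|c e Sc Se] /=; last first.
    by rewrite partial_diagMV; exact: (subgroupMV gS).
  by rewrite -[1](mulgV 1) partial_diagMV mulgV; exact: (subgroup1 gS).
move=> _ [f Mf [h Hh <-]]; apply: sub_generated.
exists (partial_diag O \o f); last by exists h.
exact: diag_monoid_comp (diag_monoid_partial LO) Mf.
Qed.

Lemma diag_span_dense n g : centr g ->
  exists2 d, diag_span A H d & forall w, size w = n -> d w = g w.
Proof.
have gS := @subgroup_generated m (\bigcup_(w in diag_monoid A) (w @` H)).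
elim: n g => [|n IH] g Cg.
  exists 1; first exact: subgroup1 gS.
  by case=> // _; rewrite !tree_root.
(* Only the activity of [h0] matters, so an element of [H] takes its place. *)
have [h0 /H_activity[h Hh hh0] h0g] := centr_activity_product Cg.
have hg : activity h = activity g by rewrite hh0.
have Sh := diag_span_id Hh.
pose k := g * h^-1.
have Ck : centr k.
  by apply: (subgroupMV (@subgroup_centralizer _ _)) => //; exact: diag_span_centr.
have k1 : activity k = 1.
  by apply/permP => y; rewrite activityM -hg activityV perm1.
(* The states of [k] are constant on each orbit, so one approximation at level [n] serves the whole
   orbit. *)
have /choice[d dE] O : exists d, O \in level1_orbits A -> diag_span A H d /\
    forall y w, orb y = O -> size w = n -> d w = state k y w.
  have [/mem_level1_orbits[y ->]|nLO] := boolP (O \in level1_orbits A); last by exists 1.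
  have [d Sd dk] := IH _ (centr_state y Ck); exists d => _; split=> // z w zy wn.
  by rewrite dk // (centr_state_const Ck k1 (_ : z \in orb y)) // orb_eqE zy.
(* The product agrees with [k] on level [n.+1], and [k * h = g]. *)
exists ((\prod_(O <- enum (level1_orbits A)) partial_diag O (d O)) * h).
  apply: (subgroupM gS) => //; rewrite big_seq; elim/big_ind: _ => [|a b|O].
  - exact: subgroup1 gS.
  - exact: subgroupM gS.
  - by rewrite mem_enum => LO; case: (dE O LO) => Sd _; exact: diag_span_partial_diag.
case=> // y w [wn]; rewrite tree_funM prod_orbits.
- rewrite partial_diag_cons orb_refl.
  have [_ /(_ y w erefl wn) ->] := dE _ (orb_level1 y).
  have := state_funE k y w; rewrite k1 perm1 => <-.
  by rewrite /k -tree_funM mulgVK.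
- by move=> O x v LO xO; rewrite partial_diag_cons (negPf xO).
- by rewrite activity_wreath perm1 orb_refl.
Qed.

Lemma centr_closure : centr = closure (diag_span A H).
Proof.
apply/seteqP; split=> [g Cg|]; last exact/closed_centralizer/diag_span_centr.
by apply/closure_level => n; exact: diag_span_dense.
Qed.

End DiagSpan.

(** * The choice of [H] *)

(** There are finitely many permutations of the letters; one representative in [B(A)] of each
    realized activity is enough. *)
Lemma finitely_generated_activities : exists H : set T,
  [/\ subgroup H, finitely_generated H, H `<=` orbit_product A &
    forall h, orbit_product A h -> exists2 h', H h' & activity h' = activity h].
Proof.
have /choice[r rE] (s : {perm 'I_m}) : exists r, orbit_product A r /\
    forall h, orbit_product A h -> activity h = s -> activity r = s.
  have [[h Bh hs]|nh] := pselect (exists2 h, orbit_product A h & activity h = s).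
    by exists h.
  (* For a permutation that [B(A)] does not realize, the default 1 keeps [r] inside [B(A)]. *)
  exists 1; split=> [|h Bh hs]; first exact: (subgroup1 subgroup_orbit_product).
  by case: nh; exists h.
exists (generated (range r)); split.
- exact: subgroup_generated.
- by exists (range r) => //; apply: finite_image; exact: finite_finset.
- apply: generated_sub; first exact: subgroup_orbit_product.
  by move=> _ [s _ <-]; case: (rE s).
- move=> h Bh; exists (r (activity h)); first by apply: sub_generated; exists (activity h).
  by have [_ /(_ h Bh erefl)] := rE (activity h).
Qed.

End AbelianSelfSimilar.

Theorem theoremB (m : nat) (hm : (2 <= m)%N) (A : set (tree_aut m))
    (A_group : subgroup A) (A_abelian : abelian_set A)
    (A_self_similar : self_similar A) (A_nontrivial : A <> [set 1]) :
  exists H : set (tree_aut m),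
    [/\ subgroup H, finitely_generated H, H `<=` orbit_product A
      & centralizer_set (diag_span A A) = closure (diag_span A H)].
Proof.
have [H [gH fgH HB Hact]] := finitely_generated_activities A_group.
by exists H; split=> //; exact: centr_closure.
Qed.
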